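(* There exists a family of almost complex structures $\{J_f\}$ on $\mathbb{C}^2$, parameterized by smooth functions $f:\mathbb{C}^2\to\mathbb{R}$, with the following properties: (1) $J_f$ coincides with the standard complex structure $i$ exactly at the points where $f=0$; (2) $J_f$ is integrable if and only if the gradient of $f$ in the $z_2$ direction is $0$ (that is, $\partial f/\partial x_2=\partial f/\partial y_2=0$ identically on $\mathbb{C}^2$); (3) if $f$ has compact support and $f\not\equiv 0$, then $h^-_{J_f}=1$.
   Context: $\mathbb{C}^2\cong\mathbb{R}^4$ has coordinates $z_1=x_1+iy_1$, $z_2=x_2+iy_2$; the standard complex structure $i$ satisfies $i\,\partial/\partial x_j=\partial/\partial y_j$, $i\,\partial/\partial y_j=-\partial/\partial x_j$. An almost complex structure $J$ on a manifold $M$ is a smooth $(1,1)$-tensor field with $J^2=-\mathrm{id}$; it is integrable if its Nijenhuis tensor $N_J(X,Y)=[JX,JY]-[X,Y]-J[JX,Y]-J[X,JY]$ vanishes identically. A smooth real $2$-form $\alpha$ is $J$-anti-invariant if $\alpha(JX,JY)=-\alpha(X,Y)$ for all vector fields $X,Y$. $h^-_J$ denotes the dimension of the real vector space of closed $J$-anti-invariant $2$-forms on $(M,J)$. *)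

(* Defs.v *)
From HB Require Import structures.
From mathcomp Require Import all_boot all_order all_algebra.
From mathcomp Require Import all_classical all_reals all_analysis.

Set Implicit Arguments.
Unset Strict Implicit.
Unset Printing Implicit Defensive.

Import Order.TTheory GRing.Theory Num.Theory.
Import numFieldNormedType.Exports.

Local Open Scope classical_set_scope.
Local Open Scope ring_scope.

(** C^2 is identified with R^4, a point being the column vector
    (x1, y1, x2, y2) of its real coordinates.  All tangent spaces are
    identified with R^4 through the coordinate fields. *)
Notation C2 R := 'cV[R]_4.

Definition ix1 : 'I_4 := @Ordinal 4 0 isT.
Definition iy1 : 'I_4 := @Ordinal 4 1 isT.
Definition ix2 : 'I_4 := @Ordinal 4 2 isT.
Definition iy2 : 'I_4 := @Ordinal 4 3 isT.

Definition coord_vec {R : realType} (i : 'I_4) : C2 R := delta_mx i 0.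

Definition partial {R : realType} {V : normedModType R} (i : 'I_4)
    (F : C2 R -> V) : C2 R -> V :=
  fun p => 'D_(coord_vec i) F p.

(** F is of class C^k: all iterated partial derivatives of order at most k
    exist and are continuous. *)
Fixpoint Ck {R : realType} {V : normedModType R} (k : nat)
    (F : C2 R -> V) : Prop :=
  continuous F /\
  match k with
  | 0%N => True
  | k'.+1 => forall i : 'I_4,
      (forall p, derivable F p (coord_vec i)) /\ Ck k' (partial i F)
  end.

Definition smooth {R : realType} {V : normedModType R} (F : C2 R -> V) : Prop :=
  forall k, Ck k F.

Definition vector_field (R : realType) := C2 R -> C2 R.

Definition lie_bracket {R : realType} (X Y : vector_field R) : vector_field R :=
  fun p => 'D_(X p) Y p - 'D_(Y p) X p.

(** A (1,1)-tensor field is given by its matrices in the coordinate frame,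
    acting on tangent vectors by left multiplication. *)
Definition tensor11 (R : realType) := C2 R -> 'M[R]_4.

Definition tapp {R : realType} (J : tensor11 R) (X : vector_field R) :
    vector_field R :=
  fun p => J p *m X p.

Definition almost_complex {R : realType} (J : tensor11 R) : Prop :=
  smooth J /\ forall p, J p *m J p = - 1%:M.

(** [delta_mx i j] sends the j-th coordinate vector to the i-th one, so this
    matrix sends d/dx_j to d/dy_j and d/dy_j to - d/dx_j. *)
Definition std_complex (R : realType) : 'M[R]_4 :=
  delta_mx iy1 ix1 - delta_mx ix1 iy1 + delta_mx iy2 ix2 - delta_mx ix2 iy2.

Definition nijenhuis {R : realType} (J : tensor11 R) (X Y : vector_field R) :
    vector_field R :=
  fun p => lie_bracket (tapp J X) (tapp J Y) p - lie_bracket X Y p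
           - tapp J (lie_bracket (tapp J X) Y) p
           - tapp J (lie_bracket X (tapp J Y)) p.

Definition integrable_acs {R : realType} (J : tensor11 R) : Prop :=
  forall X Y : vector_field R, smooth X -> smooth Y ->
  forall p, nijenhuis J X Y p = 0.

(** A 2-form is given by its antisymmetric Gram matrices in the coordinate
    frame: alpha_p(u, v) = u^T (alpha p) v. *)
Definition form_app {R : realType} (alpha : C2 R -> 'M[R]_4)
    (X Y : vector_field R) : C2 R -> R :=
  fun p => ((X p)^T *m alpha p *m Y p) 0 0.

Definition two_form {R : realType} (alpha : C2 R -> 'M[R]_4) : Prop :=
  smooth alpha /\ forall p, (alpha p)^T = - alpha p.

(** The component of d alpha on (d_i, d_j, d_k). *)
Definition ext_deriv {R : realType} (alpha : C2 R -> 'M[R]_4)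
    (i j k : 'I_4) : C2 R -> R :=
  fun p => partial i (fun q => alpha q j k) p
         + partial j (fun q => alpha q k i) p
         + partial k (fun q => alpha q i j) p.

Definition closed_form {R : realType} (alpha : C2 R -> 'M[R]_4) : Prop :=
  forall i j k p, ext_deriv alpha i j k p = 0.

Definition anti_invariant {R : realType} (J : tensor11 R)
    (alpha : C2 R -> 'M[R]_4) : Prop :=
  forall X Y : vector_field R, smooth X -> smooth Y ->
  forall p, form_app alpha (tapp J X) (tapp J Y) p = - form_app alpha X Y p.

Definition closed_anti_invariant_forms {R : realType} (J : tensor11 R) :
    set (C2 R -> 'M[R]_4) :=
  [set alpha | [/\ two_form alpha, closed_form alpha & anti_invariant J alpha]].

(** V has a basis with n elements. *)
Definition has_dim {R : realType} {E : lmodType R} (V : set E) (n : nat) : Prop :=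
  exists b : 'I_n -> E,
    (forall c : 'I_n -> R, \sum_i c i *: b i = 0 -> forall i, c i = 0) /\
    V = [set v | exists c : 'I_n -> R, v = \sum_i c i *: b i].

(** h^-_J = n *)
Definition h_minus_is {R : realType} (J : tensor11 R) (n : nat) : Prop :=
  has_dim (closed_anti_invariant_forms J) n.

Definition compact_support {R : realType} (f : C2 R -> R) : Prop :=
  compact (closure [set p | f p != 0]).

(* Main.v *)
Require Import Defs.
From HB Require Import structures.
From mathcomp Require Import all_boot all_order all_algebra.
From mathcomp Require Import all_classical all_reals all_analysis.
From mathcomp Require Import ring lra.
Set Implicit Arguments.
Unset Strict Implicit.
Unset Printing Implicit Defensive.
Import Order.TTheory GRing.Theory Num.Theory.
Import numFieldNormedType.Exports.
Local Open Scope classical_set_scope.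
Local Open Scope ring_scope.

(** The structure is J_f = i + f A, where A is the constant complex
    antilinear map d/dx1 |-> d/dx2, d/dy1 |-> - d/dy2 from the z1-plane to the
    z2-plane.  Since A anticommutes with i and A^2 = 0, J_f^2 = - id, and J_f = i
    exactly where f = 0.

    Integrability.  The Nijenhuis tensor is linear in the derivatives of f
    ([nijenhuis_Jtwist]), and in coordinates ([nijenhuis_entries]) all its
    entries are combinations of df/dx2 and df/dy2, both of which show up in
    N(d/dx2, d/dx1).

    Closed anti-invariant forms.  Pointwise, anti-invariance leaves two real
    parameters a, b ([anti_invariant_entries]); the form is
    Im ((b + i a) dz1 /\ dz2) - f a dx1 /\ dy1.  With w = f a, closedness says
    that b + i a is holomorphic in z2 and that its d-bar derivative in z1 is made
    of the two derivatives of w in the z2-plane.  Commuting derivatives,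
    w is harmonic in z2; when f has compact support so has w, hence
    w = 0.  Then b + i a is holomorphic in both variables, and its imaginary part
    a vanishes on the nonempty open set where f <> 0.  So a = 0, b is constant,
    and the form is a multiple of Im (dz1 /\ dz2) ([rigidity]).

    Both vanishing steps rest on one unique continuation principle
    ([harmonic_plane_eq0]): a function that is harmonic in a coordinate plane and
    zero near one of its points is zero on the plane.  The gradient of such a
    function is a holomorphic function phi vanishing on a disc |z|^2 <= rho.
    For l > 0, the logarithm of |phi|^2 exp (l / |z|^2) has the Laplacian
    4 l / |z|^4 > 0 off the zeros of phi, so that on an annulus this weighted
    modulus attains its maximum on the boundary, and in fact on the outer circle.
    Letting l grow forces phi = 0 inside ([holo_eq0]). *)

(** * Calculus with the partial derivatives *)

Lemma is_derive_line (R : realType) (V W : normedModType R) (F : V -> W)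
    (q v : V) (x : R) (d : W) :
  is_derive (q + x *: v) v F d -> is_derive x (1 : R) (fun t => F (q + t *: v)) d.
Proof.
move=> [+ <-]; rewrite /derivable /derive.
set g1 := (fun h : R => _) => cg.
have E : g1 = (fun h : R =>
    h^-1 *: (((fun t => F (q + t *: v)) \o shift x) (h *: 1) - F (q + x *: v))).
  apply/funext => h; rewrite /g1 /=; congr (_ *: (F _ - _)).
  by rewrite [h *: 1]mulr1 scalerDl addrC -addrA [x *: v + _]addrC.
by split; rewrite /derivable /derive -E.
Qed.

Lemma MVT_signed (R : realType) (g dg : R -> R) (t : R) :
  (forall x, is_derive x (1 : R) g (dg x)) ->
  exists2 x, `|x| <= `|t| & g t - g 0 = t * dg x.
Proof.
move=> dgP.
have cg a b : {within `[a, b], continuous g}.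
  apply/continuous_subspaceT => r.
  by apply/differentiable_continuous/derivable1_diffP; case: (dgP r).
have [t0|/ltW t0] := leP 0 t.
  have [x + ->] := MVT_segment t0 (fun x _ => dgP x) (cg _ _).
  rewrite in_itv /= => /andP[x0 xt]; exists x; last by rewrite subr0 mulrC.
  by rewrite !ger0_norm.
have [x + E] := MVT_segment t0 (fun x _ => dgP x) (cg _ _).
rewrite in_itv /= => /andP[tx x0]; exists x.
  by rewrite !ler0_norm // lerN2.
by rewrite -opprB E sub0r mulrN opprK mulrC.
Qed.

Section smooth_calculus.
Context {R : realType}.
Local Notation e := (@coord_vec R).

Section vector_valued.
Context {V : normedModType R}.
Implicit Types F : C2 R -> V.

Lemma smooth_continuous F : smooth F -> continuous F.
Proof. by move=> /(_ 0%N)[]. Qed.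

Lemma smooth_derivable F i p : smooth F -> derivable F p (e i).
Proof. by move=> /(_ 1%N)[_ /(_ i)[]]. Qed.

Lemma smooth_partial F i : smooth F -> smooth (partial i F).
Proof. by move=> sF k; have [_ /(_ i)[]] := sF k.+1. Qed.

Lemma is_derive_partial F i (q : C2 R) x : smooth F ->
  is_derive x (1 : R) (fun t => F (q + t *: e i)) (partial i F (q + x *: e i)).
Proof. by move=> sF; apply/is_derive_line/derivableP/smooth_derivable. Qed.

Lemma partial_cst (v : V) i : partial i (fun=> v) = fun=> 0.
Proof. by apply/funext => p; rewrite /partial derive_cst. Qed.

Lemma smooth_cst (v : V) : smooth (fun=> v : V).
Proof.
move=> k; elim: k v => [|k IH] v; split=> //; try exact: cst_continuous.
move=> i; split; first by move=> p; exact: derivable_cst.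
by rewrite partial_cst; exact: IH.
Qed.

End vector_valued.

Implicit Types F : C2 R -> R.

(** The differentiability of a C^1 function, one coordinate at a time: the
    increment in the direction e_i, taken after moving along v, is handled by the
    mean value theorem, and continuity of the i-th partial derivative replaces
    its value at the intermediate point by the one at p. *)
Lemma is_derive_add_coord F (p v : C2 R) d (c : R) i : smooth F ->
  is_derive p v F d -> is_derive p (v + c *: e i) F (d + c * partial i F p).
Proof.
move=> sF [dF <-].
suff cv : h^-1 *: (F (h *: (v + c *: e i) + p) - F p) @[h --> 0^'] -->
    'D_v F p + c * partial i F p.
  by split; [apply/cvg_ex; eexists; exact: cv|exact/cvg_lim].
rewrite (_ : (fun h => _) = (fun h : R => h^-1 *: (F (h *: v + p) - F p)
    + h^-1 *: (F (h *: v + p + (h * c) *: e i) - F (h *: v + p)))); last first.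
  apply/funext => h; rewrite -scalerDr; congr (_ *: _).
  by rewrite [RHS]addrC subrKA scalerDr scalerA addrAC.
apply: cvgD; first exact: dF.
apply/cvgrPdist_le => eps eps0.
have cF : {for p, continuous (partial i F)}.
  exact/smooth_continuous/smooth_partial.
have eps1 : 0 < eps / (`|c| + 1) by rewrite divr_gt0 // ltr_wpDl.
have : \forall q \near p, `|partial i F p - partial i F q| <= eps / (`|c| + 1).
  by move/cvgrPdist_le : cF; apply.
move=> /nbhs_ballP[/= r r0 rF].
have K0 : 0 < `|v| + `|c| * `|e i| + 1 by rewrite ltr_wpDl // addr_ge0 // mulr_ge0.
near=> h.
have h0 : h != 0 by near: h; exact: nbhs_dnbhs_neq.
have [x xh] := MVT_signed (g := fun t => F (h *: v + p + t *: e i)) (h * c)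
  (fun x => is_derive_partial i (h *: v + p) x sF).
rewrite /= scale0r addr0 => ->.
rewrite -mulrA [_ *: _](mulKf h0) -mulrBr normrM.
apply: le_trans (_ : (`|c| + 1) * (eps / (`|c| + 1)) <= _); last first.
  by rewrite mulrC divfK // gt_eqF // ltr_wpDl.
apply: ler_pM => //; first by rewrite lerDl.
apply: rF; rewrite -ball_normE /=.
rewrite -normrN opprB addrAC addrK.
have hr : `|h| * (`|v| + `|c| * `|e i| + 1) < r.
  rewrite -ltr_pdivlMr //; near: h; exact: dnbhs0_lt (divr_gt0 _ _).
apply: le_lt_trans hr; rewrite (le_trans (ler_normD _ _)) // !normrZ.
have : `|x| * `|e i| <= `|h * c| * `|e i| by apply: ler_wpM2r.
rewrite normrM => xe; have := normr_ge0 h; nra.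
Unshelve. all: by end_near. Qed.

Lemma coord_sum (v : C2 R) : \sum_i v i 0 *: e i = v.
Proof.
apply/colP => k; rewrite summxE (bigD1 k) //= big1 ?addr0.
  by rewrite !mxE !eqxx mulr1.
by move=> j jk; rewrite !mxE eq_sym (negbTE jk) mulr0.
Qed.

Lemma is_derive_smooth F (p v : C2 R) : smooth F ->
  is_derive p v F (\sum_i v i 0 * partial i F p).
Proof.
move=> sF.
suff /(_ (index_enum _)) : forall s, is_derive p (\sum_(i <- s) v i 0 *: e i) F
    (\sum_(i <- s) v i 0 * partial i F p) by rewrite coord_sum.
elim=> [|i s IH]; first by rewrite !big_nil; exact: is_derive0.
rewrite !big_cons addrC [X in is_derive _ _ _ X]addrC.
exact: is_derive_add_coord.
Qed.

Lemma smooth_coord m n (F : C2 R -> 'M[R]_(m, n)) i j :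
  smooth F -> smooth (fun p => F p i j).
Proof.
move=> sF k; have := sF k; elim: k F {sF} => [|k IH] F [cF dF]; split=> //.
- by move=> p; apply: (@continuous_comp _ _ _ F (fun M => M i j));
    [exact: cF|exact: coord_continuous].
- by move=> p; apply: (@continuous_comp _ _ _ F (fun M => M i j));
    [exact: cF|exact: coord_continuous].
- move=> l; have [dFl cFl] := dF l; split.
    by move=> p; have /derivable_mxP := dFl p; apply.
  have -> : partial l (fun p => F p i j) = fun p => partial l F p i j.
    by apply/funext => p; rewrite /partial derive_mx // mxE.
  exact: IH.
Qed.

Lemma is_derive_mxP m n (F : C2 R -> 'M[R]_(m, n)) p v D :
  is_derive p v F D <-> forall i j, is_derive p v (fun q => F q i j) (D i j).
Proof.
split=> [[dF <-] i j|H].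
  rewrite derive_mx // mxE; apply: derivableP.
  by move/derivable_mxP: dF; apply.
have dF : derivable F p v by apply/derivable_mxP => i j; case: (H i j).
by split=> //; rewrite derive_mx //; apply/matrixP => i j; rewrite mxE; case: (H i j).
Qed.

Lemma smooth_derivable_dir m n (F : C2 R -> 'M[R]_(m, n)) p v :
  smooth F -> derivable F p v.
Proof.
move=> sF; apply/derivable_mxP => i j.
by case: (is_derive_smooth p v (smooth_coord i j sF)).
Qed.

Lemma is_derive_mulmx m n k (M : C2 R -> 'M[R]_(m, n)) (N : C2 R -> 'M[R]_(n, k))
    p v DM DN : is_derive p v M DM -> is_derive p v N DN ->
  is_derive p v (fun q => M q *m N q) (DM *m N p + M p *m DN).
Proof.
move=> /is_derive_mxP dM /is_derive_mxP dN; apply/is_derive_mxP => i j.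
have -> : (fun q => (M q *m N q) i j) = \sum_l (fun q => M q i l * N q l j).
  by apply/funext => q; rewrite mxE fct_sumE.
have dMN l : is_derive p v (fun q => M q i l * N q l j)
    (DM i l * N p l j + M p i l * DN l j).
  apply: (is_derive_eq (is_deriveM (dM i l) (dN l j))).
  by rewrite /GRing.scale /= addrC mulrC.
apply: (is_derive_eq (is_derive_sum dMN)).
by rewrite !mxE -big_split.
Qed.

Lemma Ck_affine k F m n (C A : 'M[R]_(m, n)) :
  Ck k F -> Ck k (fun p => C + F p *: A).
Proof.
have cG (H : C2 R -> R) (B : 'M[R]_(m, n)) :
    continuous H -> continuous (fun p => B + H p *: A).
  by move=> cH p; exact: (cvgD (cvg_cst B) (cvgZ (cH p) (cvg_cst A))).
elim: k F C => [|k IH] F C [cF dF]; split=> //; try exact: cG.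
move=> i; have [dFi cFi] := dF i.
have D p : is_derive p (e i) (fun q => C + F q *: A) (partial i F p *: A).
  apply/is_derive_mxP => r c; rewrite mxE.
  have -> : (fun q => (C + F q *: A) r c) = cst (C r c) + A r c *: F.
    by apply/funext => q; rewrite !mxE mulrC.
  apply: (is_derive_eq (is_deriveD (is_derive_cst _ _ _)
    (is_deriveZ _ (derivableP (dFi p))))).
  by rewrite add0r mulrC.
split; first by move=> p; case: (D p).
have -> : partial i (fun q => C + F q *: A) = fun p => 0 + partial i F p *: A.
  by apply/funext => p; rewrite add0r; case: (D p).
exact: IH.
Qed.

(** The second difference of F over a parallelogram with sides h e_i and h e_j
    is, by two applications of the mean value theorem in either order, h^2 times
    a value of each mixed derivative near p; so both agree at p. *)
Lemma partial_sym F i j : smooth F ->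
  partial i (partial j F) = partial j (partial i F).
Proof.
have thirds (u v w : R) : w <= u + v -> u < w / 3 -> v < w / 3 -> ~ 0 < w / 3.
  by lra.
move=> sF; apply/funext => p; apply/eqP; rewrite -subr_eq0; apply/negP => /negP.
move aE: (partial i _ p) => a; move bE: (partial j _ p) => b ab.
have eps0 : 0 < `|a - b| / 3 by rewrite divr_gt0 // normr_gt0.
have near_p (G : C2 R -> R) c : smooth G -> G p = c ->
    \forall q \near p, `|c - G q| < `|a - b| / 3.
  by move=> /smooth_continuous /(_ p) /cvgrPdist_lt + <-; apply.
have [r r0 rP] : exists2 r : R, 0 < r & forall q, `|q - p| < r ->
    `|a - partial i (partial j F) q| < `|a - b| / 3 /\
    `|b - partial j (partial i F) q| < `|a - b| / 3.
  have /nbhs_ballP[r r0 rP] : \forall q \near p,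
      `|a - partial i (partial j F) q| < `|a - b| / 3 /\
      `|b - partial j (partial i F) q| < `|a - b| / 3.
    apply: (filterI (near_p _ a _ _) (near_p _ b _ _)) => //;
      by do 2! apply: smooth_partial.
  by exists r => // q qr; apply: rP; rewrite -ball_normE /= distrC.
have K0 : 0 < `|e i| + `|e j| + 1 by rewrite ltr_wpDl // addr_ge0.
have [h h0 hK] : exists2 h, 0 < h & h * (`|e i| + `|e j| + 1) < r.
  exists (r / (`|e i| + `|e j| + 1) / 2); first by rewrite !divr_gt0.
  rewrite mulrAC divfK ?(gt_eqF K0) //.
  by rewrite ltr_pdivrMr // ltr_pMr // ltr1n.
have hr x y : `|x| <= `|h| -> `|y| <= `|h| -> `|x *: e i + y *: e j| < r.
  move=> xh yh; apply: le_lt_trans hK; rewrite (le_trans (ler_normD _ _)) // !normrZ.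
  move: xh yh; rewrite (gtr0_norm h0) => xh yh.
  by rewrite !mulrDr mulr1 ler_wpDr ?(ltW h0) // lerD // ler_wpM2r.
(* the left side is symmetric in the two directions: it serves for both orders *)
have second (G : C2 R -> R) u v (i1 j1 : 'I_4) : smooth G ->
   exists2 xy : R * R, `|xy.1| <= `|u| /\ `|xy.2| <= `|v| &
   G (p + u *: e i1 + v *: e j1) - G (p + u *: e i1) - G (p + v *: e j1) + G p =
   u * v * partial j1 (partial i1 G) (p + xy.1 *: e i1 + xy.2 *: e j1).
  move=> sG.
  have dG t : is_derive t (1 : R)
      (fun t => G (p + v *: e j1 + t *: e i1) - G (p + t *: e i1))
      (partial i1 G (p + v *: e j1 + t *: e i1) - partial i1 G (p + t *: e i1)).
    exact: (is_deriveB (is_derive_partial i1 (p + v *: e j1) t sG)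
                       (is_derive_partial i1 p t sG)).
  have [x xu] := MVT_signed u dG.
  rewrite /= !scale0r !addr0 => E.
  have [y yv] := MVT_signed v (fun y =>
    is_derive_partial j1 (p + x *: e i1) y (smooth_partial i1 sG)).
  rewrite /= !scale0r !addr0 => E'.
  exists (x, y) => //=; rewrite -mulrA -E' [p + x *: _ + _]addrAC -E.
  by rewrite [p + u *: _ + _]addrAC; ring.
have [[x y] /= [xh yh] E1] := second F h h i j sF.
have [[y' x'] /= [yh' xh'] E2] := second F h h j i sF.
have E : partial j (partial i F) (p + x *: e i + y *: e j) =
    partial i (partial j F) (p + y' *: e j + x' *: e i).
  have hh0 : h * h != 0 by rewrite mulf_neq0 // gt_eqF.
  apply: (mulfI hh0); apply: etrans (esym E1) _; apply: etrans E2.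
  rewrite [p + h *: e j + _]addrAC.
  move: (F _) (F (p + h *: e i)) (F (p + h *: e j)) (F p) => *; ring.
have shiftP u v : p + u + v - p = u + v.
  by rewrite -[p + u + v]addrA [p + _]addrC addrK.
have [|_ B] := rP (p + x *: e i + y *: e j); first by rewrite shiftP; exact: hr.
have [|A _] := rP (p + y' *: e j + x' *: e i).
  by rewrite shiftP addrC; exact: hr.
move: A B; rewrite E; move: (partial i _ _) => c A B.
have T : `|a - b| <= `|a - c| + `|b - c|.
  have -> : a - b = (a - c) - (b - c) by ring.
  exact: ler_normB.
exact: thirds T A B eps0.
Qed.

Lemma partialN F i p : smooth F -> partial i (fun q => - F q) p = - partial i F p.
Proof. by move=> sF; rewrite /partial deriveN //; exact: smooth_derivable. Qed.

Lemma partialD F G i p : smooth F -> smooth G ->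
  partial i (fun q => F q + G q) p = partial i F p + partial i G p.
Proof. by move=> sF sG; rewrite /partial deriveD //; exact: smooth_derivable. Qed.

Lemma smoothD F G : smooth F -> smooth G -> smooth (fun p => F p + G p).
Proof.
have c (A B : C2 R -> R) : smooth A -> smooth B -> continuous (fun p => A p + B p).
  by move=> sA sB p; exact: (continuousD (@smooth_continuous _ A sA p) (@smooth_continuous _ B sB p)).
move=> sF sG k; elim: k F G sF sG => [|k IH] F G sF sG; first by split=> //; exact: c.
split; first exact: c.
move=> i; split; first by move=> p; apply: derivableD; exact: smooth_derivable.
rewrite (_ : partial i _ = fun p => partial i F p + partial i G p).
  by apply: IH; exact: smooth_partial.
by apply/funext => p; exact: partialD.
Qed.

Lemma smoothN F : smooth F -> smooth (fun p => - F p).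
Proof.
have c (A : C2 R -> R) : smooth A -> continuous (fun p => - A p).
  by move=> sA p; exact: (continuousN (@smooth_continuous _ A sA p)).
move=> sF k; elim: k F sF => [|k IH] F sF; first by split=> //; exact: c.
split; first exact: c.
move=> i; split; first by move=> p; apply: derivableN; exact: smooth_derivable.
rewrite (_ : partial i _ = fun p => - partial i F p).
  by apply: IH; exact: smooth_partial.
by apply/funext => p; exact: partialN.
Qed.

Lemma near_partial0 F i (c : C2 R) :
  (\forall q \near c, F q = 0) -> \forall q \near c, partial i F q = 0.
Proof.
move=> /nbhs_interior F0; near=> q.
rewrite /partial (@near_eq_derive _ _ _ _ (fun=> 0)) ?derive_cst //.
by near: q; exact: F0.
Unshelve. all: by end_near. Qed.

End smooth_calculus.

Arguments smooth_continuous {R V F} sF p : rename.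

(** * The maximum principle for a weighted modulus *)

Section max.
Context {R : realType}.

Lemma second_derivative_at_max (g dg : R -> R) (x c eps : R) : 0 < eps ->
  (forall t, `|t - x| < eps -> is_derive t (1 : R) g (dg t)) ->
  is_derive x (1 : R) dg c -> (forall t, `|t - x| < eps -> g t <= g x) ->
  dg x = 0 /\ c <= 0.
Proof.
move=> eps0 dgP [ddg cE] gmax.
have itvP t : t \in `]x - eps, x + eps[ -> `|t - x| < eps.
  by rewrite in_itv /= ltr_distl.
have dgx : dg x = 0.
  have [] := @derive1_at_max R g (x - eps) (x + eps) x.
  - by rewrite lerD2l ge0_cp // ltW.
  - by move=> t /itvP /dgP [].
  - by rewrite in_itv /= gtrBl ltrDl eps0.
  - by move=> t /itvP; exact: gmax.
  - by move=> _; have [|_ ->] := dgP x; rewrite ?subrr ?normr0.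
split=> //; rewrite leNgt; apply/negP => c0.
have /cvgr_gt /(_ _ c0) : h^-1 *: (dg (h *: 1 + x) - dg x) @[h --> 0^'] --> c.
  by rewrite -cE; exact: ddg.
move=> /nbhs_ballP[/= r r0 rP].
have [h /andP[h0 hr] heps] : exists2 h, 0 < h < r & h < eps.
  exists (Num.min r eps / 2).
    by rewrite divr_gt0 ?lt_min ?r0 //= ltr_pdivrMr // gt_min ltr_pMr // ltr1n.
  by rewrite ltr_pdivrMr // gt_min [eps < _]ltr_pMr // [1 < 2]ltr1n orbT.
have xh : x < x + h by rewrite ltrDl.
have near_x t : t \in `]x, x + h[ -> `|t - x| < eps.
  rewrite in_itv /= => /andP[xt th]; rewrite gtr0_norm ?subr_gt0 //.
  by rewrite (lt_trans _ heps) // ltrBlDl.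
have cg : {within `[x, x + h], continuous g}.
  apply: continuous_in_subspaceT => t; rewrite inE /= in_itv /= => /andP[xt th].
  apply/differentiable_continuous/derivable1_diffP.
  have [] // := dgP t; rewrite ger0_norm ?subr_ge0 // (le_lt_trans _ heps) //.
  by rewrite lerBlDl.
have [t + E] := MVT xh (fun t tI => dgP t (near_x t tI)) cg.
rewrite in_itv /= => /andP[xt th].
have : 0 < (t - x)^-1 *: (dg ((t - x) *: 1 + x) - dg x).
  apply: rP; last by rewrite /= subr_eq0 gt_eqF.
  rewrite -ball_normE /= sub0r normrN gtr0_norm ?subr_gt0 //.
  by rewrite (lt_trans _ hr) // ltrBlDl.
rewrite dgx subr0 [_ *: 1]mulr1 subrK pmulr_rgt0 ?invr_gt0 ?subr_gt0 // => dgt.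
have : g x < g (x + h).
  by rewrite -subr_gt0 E mulr_gt0 // addrAC subrr add0r.
by rewrite ltNge gmax // addrAC subrr add0r gtr0_norm.
Qed.

Lemma is_derive_invD (k t : R) : t ^+ 2 + k != 0 ->
  is_derive t (1 : R) (fun t => (t ^+ 2 + k)^-1) (- 2 * t * ((t ^+ 2 + k)^-1) ^+ 2).
Proof.
move=> s0.
have ds : is_derive t (1 : R) (fun t => t ^+ 2 + k) (2 * t).
  have it := is_derive_id t (1 : R).
  apply: (is_derive_eq (is_deriveD (is_deriveM it it) (is_derive_cst k t _))).
  by rewrite addr0 /GRing.scale /=; ring.
apply: (is_derive_eq (@is_deriveV _ (fun t => t ^+ 2 + k) _ _ _ s0 ds)).
rewrite /GRing.scale /= exprVn; ring.
Qed.

Lemma is_derive_weight (lam k t : R) : t ^+ 2 + k != 0 ->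
  is_derive t (1 : R) (fun t => expR (lam * (t ^+ 2 + k)^-1))
    (expR (lam * (t ^+ 2 + k)^-1) * (lam * (- 2 * t * (t ^+ 2 + k)^-1 ^+ 2))).
Proof.
move=> s0; exact: (@is_derive1_comp _ _ (fun t => lam * (t ^+ 2 + k)^-1) _ _ _
  (is_derive_expR _) (is_deriveZ lam (is_derive_invD s0))).
Qed.

Lemma is_derive_weighted (lam k t : R) (mu : R -> R) dmu : t ^+ 2 + k != 0 ->
  is_derive t (1 : R) mu dmu ->
  is_derive t (1 : R) (fun t => mu t * expR (lam * (t ^+ 2 + k)^-1))
    ((dmu - 2 * lam * (t * mu t) * (t ^+ 2 + k)^-1 ^+ 2) *
     expR (lam * (t ^+ 2 + k)^-1)).
Proof.
move=> s0 dm.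
apply: (is_derive_eq (is_deriveM dm (is_derive_weight lam s0))).
by rewrite /GRing.scale /=; ring.
Qed.

(** The first and second derivative tests along one coordinate line for the
    product of mu with the radial weight exp (lam / s), s = t^2 + k being the
    squared distance to the origin when k is the square of the other coordinate.
    The bounds lo and hi keep s positive and the maximum interior. *)
Lemma weighted_max (lam k x c lo hi : R) (mu dmu : R -> R) : 0 < lo ->
  (forall t, is_derive t (1 : R) mu (dmu t)) -> is_derive x (1 : R) dmu c ->
  lo < x ^+ 2 + k < hi ->
  (forall t, lo <= t ^+ 2 + k <= hi ->
    mu t * expR (lam * (t ^+ 2 + k)^-1) <= mu x * expR (lam * (x ^+ 2 + k)^-1)) ->
  let r := (x ^+ 2 + k)^-1 in
  dmu x = 2 * lam * x * mu x * r ^+ 2 /\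
  c <= 2 * lam * (mu x * r ^+ 2 + x * dmu x * r ^+ 2) - 8 * lam * x ^+ 2 * mu x * r ^+ 3.
Proof.
move=> lo0 dm ddm xI xmax r.
have [eps eps0 epsP] : exists2 eps : R, 0 < eps &
    forall t, `|t - x| < eps -> lo < t ^+ 2 + k < hi.
  have cs : (t ^+ 2 + k) @[t --> x] --> x ^+ 2 + k.
    by apply: cvgD; [exact: exprn_continuous|exact: cvg_cst].
  have /andP[xlo xhi] := xI.
  have /nbhs_ballP[eps eps0 epsP] : \forall t \near x, lo < t ^+ 2 + k /\ t ^+ 2 + k < hi.
    by apply: filterI; [exact: cvgr_gt cs _ xlo|exact: cvgr_lt cs _ xhi].
  exists eps => // t tx; apply/andP; apply: epsP.
  by rewrite -ball_normE /= distrC.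
have s0 t : `|t - x| < eps -> t ^+ 2 + k != 0.
  by move=> /epsP /andP[/(lt_trans lo0) /gt_eqF ->].
have xx : `|x - x| < eps by rewrite subrr normr0.
have dr := is_derive_invD (s0 x xx).
pose dg t := (dmu t - 2 * lam * (t * mu t) * (t ^+ 2 + k)^-1 ^+ 2) *
     expR (lam * (t ^+ 2 + k)^-1).
have ddg : is_derive x (1 : R) dg
    ((c - 2 * lam * (mu x * r ^+ 2 + x * dmu x * r ^+ 2) + 8 * lam * x ^+ 2 * mu x * r ^+ 3
      - 2 * lam * x * r ^+ 2 * (dmu x - 2 * lam * x * mu x * r ^+ 2))
     * expR (lam * r)).
  have dB := is_deriveM (is_deriveZ (2 * lam) (is_deriveM (is_derive_id x (1 : R)) (dm x)))
    (is_deriveM dr dr).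
  have dE := is_derive_weight lam (s0 x xx).
  apply: (is_derive_eq (is_deriveM (is_deriveB ddm dB) dE)).
  rewrite /GRing.scale /= -/r; set E := expR _.
  transitivity ((dmu x - 2 * lam * (x * mu x) * (r * r)) *
      (E * (lam * (-2 * x * r ^+ 2))) +
    E * (c - (2 * lam * (x * mu x) * (r * (-2 * x * r ^+ 2) + r * (-2 * x * r ^+ 2))
      + r * r * (2 * lam * (x * dmu x + mu x * 1))))) => //.
  by ring.
pose g t := mu t * expR (lam * (t ^+ 2 + k)^-1).
have dgP t : `|t - x| < eps -> is_derive t (1 : R) g (dg t).
  by move=> tx; exact: is_derive_weighted (s0 t tx) (dm t).
have gmax t : `|t - x| < eps -> g t <= g x.
  move=> tx; apply: xmax; have /andP[h1 h2] := epsP t tx.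
  by rewrite !ltW.
have [+ H] := second_derivative_at_max eps0 dgP ddg gmax.
move=> /eqP; rewrite /dg mulf_eq0 (gt_eqF (expR_gt0 _)) orbF subr_eq0 -/r => /eqP d0.
have d1 : dmu x = 2 * lam * x * mu x * r ^+ 2 by rewrite d0; ring.
split=> //; move: H; rewrite pmulr_lle0 ?expR_gt0 // -d1 subrr mulr0 subr0.
by move: (mu x * r ^+ 2 + _) (8 * lam * _ * _ * _) => u v; lra.
Qed.

(** The tests in x and in y contradict each other at a point where m > 0: here
    r = 1 / s, A and B are the derivatives of m and L1, L2 its second derivatives.
    The hypothesis m (L1 + L2) = A^2 + B^2 is the harmonicity of ln m, valid for
    m = |phi|^2 with phi holomorphic; the sum of the two tests bounds the same
    quantity by A^2 + B^2 - 4 lam m^2 r^2. *)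
Lemma weighted_max_absurd (x y m r lam A B L1 L2 : R) :
  0 < m -> 0 < r -> 0 < lam -> r * (x ^+ 2 + y ^+ 2) = 1 ->
  A = 2 * lam * x * m * r ^+ 2 -> B = 2 * lam * y * m * r ^+ 2 ->
  L1 <= 2 * lam * (m * r ^+ 2 + x * A * r ^+ 2) - 8 * lam * x ^+ 2 * m * r ^+ 3 ->
  L2 <= 2 * lam * (m * r ^+ 2 + y * B * r ^+ 2) - 8 * lam * y ^+ 2 * m * r ^+ 3 ->
  m * (L1 + L2) = A ^+ 2 + B ^+ 2 -> False.
Proof.
move=> m0 r0 lam0 rs -> -> h1 h2.
have -> : (2 * lam * x * m * r ^+ 2) ^+ 2 + (2 * lam * y * m * r ^+ 2) ^+ 2 =
  4 * lam ^+ 2 * m ^+ 2 * r ^+ 3 * (r * (x ^+ 2 + y ^+ 2)) by ring.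
rewrite rs mulr1 => E.
have : L1 + L2 <= 4 * lam * m * r ^+ 2 * (1 - 2 * (r * (x ^+ 2 + y ^+ 2)))
    + 4 * lam ^+ 2 * m * r ^+ 3 * (r * (x ^+ 2 + y ^+ 2)).
  apply: le_trans (lerD h1 h2) _; rewrite le_eqVlt; apply/orP; left; apply/eqP; ring.
rewrite rs -(ler_pM2l m0) E => H.
have : 0 < 4 * lam * m ^+ 2 * r ^+ 2 by rewrite !mulr_gt0 ?exprn_gt0.
move: H; clear; nra.
Qed.

End max.

(** * Unique continuation for holomorphic functions of one variable *)

Section holo.
Context {R : realType}.

(** P + i Q is holomorphic in x + i y, with complex derivative U + i V: the
    Cauchy-Riemann equations are built in. *)
Definition holo_deriv (P Q U V : R -> R -> R) := forall x y,
  [/\ is_derive x (1 : R) (P^~ y) (U x y), is_derive y (1 : R) (P x) (- V x y),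
      is_derive x (1 : R) (Q^~ y) (V x y) & is_derive y (1 : R) (Q x) (U x y)].

Lemma continuous_sum_sqr (T : topologicalType) (f g : T -> R) :
  continuous f -> continuous g -> continuous (fun z => f z ^+ 2 + g z ^+ 2).
Proof.
move=> cf cg z.
exact: (cvgD (cvgM (cf z) (cf z)) (cvgM (cg z) (cg z))).
Qed.

Lemma continuous_normsq : continuous (fun z : R * R => z.1 ^+ 2 + z.2 ^+ 2).
Proof.
by apply: continuous_sum_sqr => z; [exact: cvg_fst|exact: cvg_snd].
Qed.

Lemma compact_annulus (a b : R) :
  compact [set z : R * R | a <= z.1 ^+ 2 + z.2 ^+ 2 <= b].
Proof.
have cs := continuous_normsq.
have cl : closed [set z : R * R | a <= z.1 ^+ 2 + z.2 ^+ 2 <= b].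
  rewrite (_ : [set z | _] = (fun z : R * R => z.1 ^+ 2 + z.2 ^+ 2) @^-1` `[a, b]%classic).
    by apply: preimage_closed; [move=> z _; exact: cs|exact: interval_closed].
  by apply/seteqP; split => z /=; rewrite in_itv.
have I := @segment_compact R (- (`|b| + 1)) (`|b| + 1).
apply: (subclosed_compact cl (compact_setX I I)) => z /= /andP[_ zb].
have bb : z.1 ^+ 2 + z.2 ^+ 2 <= `|b| by rewrite (le_trans zb) // ler_norm.
have b0 := normr_ge0 b.
have small (w : R) : w ^+ 2 <= `|b| -> - (`|b| + 1) <= w <= `|b| + 1.
  by move=> h; rewrite -ler_norml leNgt; apply/negP => h'; move: h;
     rewrite -real_normK ?num_real //; nra.
by split; rewrite /= in_itv /=; apply: small; nra.
Qed.

(** If m = P^2 + Q^2 were positive at (x0, y0), at squared distance s0 from the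
    origin, consider m exp (lam / s) on the annulus rho <= s <= s0 + 1.  It is zero
    on the inner circle, and lam is so large that its value at (x0, y0) exceeds
    all its values on the outer circle.  Its maximum is then interior, which
    [weighted_max_absurd] excludes. *)
Lemma holo_eq0 (P Q U V S T : R -> R -> R) (rho : R) :
  holo_deriv P Q U V -> holo_deriv U V S T ->
  continuous (fun z : R * R => P z.1 z.2) ->
  continuous (fun z : R * R => Q z.1 z.2) ->
  0 < rho -> (forall x y, x ^+ 2 + y ^+ 2 <= rho -> P x y = 0 /\ Q x y = 0) ->
  forall x y, P x y = 0 /\ Q x y = 0.
Proof.
move=> PQ UV cP cQ rho0 van x0 y0.
pose m x y := P x y ^+ 2 + Q x y ^+ 2.
have m_ge0 x y : 0 <= m x y by rewrite addr_ge0 ?sqr_ge0.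
have [/eqP|m0] := boolP (m x0 y0 == 0).
  by move=> /eqP; rewrite paddr_eq0 ?sqr_ge0 // !sqrf_eq0 => /andP[/eqP-> /eqP->].
exfalso; have {}m0 : 0 < m x0 y0 by rewrite lt_neqAle eq_sym m0 m_ge0.
have mrho x y : x ^+ 2 + y ^+ 2 <= rho -> m x y = 0.
  by move=> /van[]; rewrite /m => -> ->; rewrite expr0n addr0.
pose s0 := x0 ^+ 2 + y0 ^+ 2.
have rs0 : rho < s0 by rewrite ltNge; apply/negP => /mrho; apply/eqP; rewrite gt_eqF.
have s00 : 0 < s0 := lt_trans rho0 rs0.
pose A := [set z : R * R | rho <= z.1 ^+ 2 + z.2 ^+ 2 <= s0 + 1].
have cA : compact A := @compact_annulus rho (s0 + 1).
have A0 : A (x0, y0) by rewrite /A /= -/s0 (ltW rs0) lerDl ler01.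
have cm : continuous (fun z : R * R => m z.1 z.2).
  exact: continuous_sum_sqr.
have AN0 : A !=set0 by exists (x0, y0).
have [zM _ mM] := compact_EVT_max AN0 cA (continuous_subspaceT cm).
set M := m zM.1 zM.2 in mM.
have M0 : 0 < M by apply: lt_le_trans m0 (mM (x0, y0) _); rewrite inE.
have gap : 0 < s0^-1 - (s0 + 1)^-1.
  have s10 : 0 < s0 + 1 := addr_gt0 s00 ltr01.
  by rewrite subr_gt0 ltf_pV2 ?posrE // ltrDl ltr01.
(* by 1 + u <= exp u, this exponent makes exp (lam / s0 - lam / (s0 + 1)) exceed
   M / m x0 y0 *)
pose lam := M / m x0 y0 / (s0^-1 - (s0 + 1)^-1).
have lam0 : 0 < lam by rewrite !divr_gt0.
have lamP : M * expR (lam * (s0 + 1)^-1) < m x0 y0 * expR (lam * s0^-1).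
  have -> : lam * s0^-1 = M / m x0 y0 + lam * (s0 + 1)^-1.
    by rewrite -[X in X + _](divfK (lt0r_neq0 gap)) -/lam -mulrDr subrK.
  rewrite expRD mulrA ltr_pM2r ?expR_gt0 //.
  have : m x0 y0 * (1 + M / m x0 y0) <= m x0 y0 * expR (M / m x0 y0).
    by rewrite ler_pM2l // expR_ge1Dx.
  by apply: lt_le_trans; rewrite mulrDr mulr1 mulrCA divff ?mulr1 ?ltrDr // gt_eqF.
pose h (z : R * R) := m z.1 z.2 * expR (lam * (z.1 ^+ 2 + z.2 ^+ 2)^-1).
have ch : {within A, continuous h}.
  apply: continuous_in_subspaceT => z; rewrite inE => /andP[rz _].
  have sz : z.1 ^+ 2 + z.2 ^+ 2 != 0 by rewrite gt_eqF // (lt_le_trans rho0).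
  have cs : {for z, continuous (fun z : R * R => z.1 ^+ 2 + z.2 ^+ 2)}.
    exact: continuous_normsq.
  apply: (@cvgM _ _ _ _ (fun z : R * R => m z.1 z.2)); first exact: cm.
  have ci : {for z, continuous (fun z : R * R => lam * (z.1 ^+ 2 + z.2 ^+ 2)^-1)}.
    exact: (cvgM (cvg_cst lam) (cvgV sz cs)).
  exact: (cvg_comp _ _ ci (@continuous_expR _ _)).
have [[x y] /set_mem /= /andP[lo hi] hmax] := compact_EVT_max AN0 cA ch.
have h0 : m x0 y0 * expR (lam * s0^-1) <= m x y * expR (lam * (x ^+ 2 + y ^+ 2)^-1).
  by apply: (hmax (x0, y0)); rewrite inE.
have mxy : 0 < m x y.
  rewrite -(pmulr_lgt0 _ (expR_gt0 (lam * (x ^+ 2 + y ^+ 2)^-1))).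
  by apply: lt_le_trans h0; rewrite mulr_gt0 // expR_gt0.
have {}lo : rho < x ^+ 2 + y ^+ 2.
  by rewrite ltNge; apply/negP => /mrho; apply/eqP; rewrite gt_eqF.
have {}hi : x ^+ 2 + y ^+ 2 < s0 + 1.
  rewrite lt_neqAle hi andbT; apply/eqP => E.
  move: h0; rewrite E leNgt => /negP; apply; apply: le_lt_trans lamP.
  rewrite ler_pM2r ?expR_gt0 //; apply: (mM (x, y)); rewrite inE /A /= E lexx andbT.
  by rewrite -E ltW.
have s_gt0 : 0 < x ^+ 2 + y ^+ 2 := lt_trans rho0 lo.
have dmx t : is_derive t (1 : R) (m^~ y) (2 * (P t y * U t y + Q t y * V t y)).
  have [dP _ dQ _] := PQ t y.
  apply: (is_derive_eq (is_deriveD (is_deriveM dP dP) (is_deriveM dQ dQ))).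
  by rewrite /GRing.scale /=; ring.
have ddmx : is_derive x (1 : R) (fun t => 2 * (P t y * U t y + Q t y * V t y))
   (2 * (U x y ^+ 2 + V x y ^+ 2 + P x y * S x y + Q x y * T x y)).
  have [dP _ dQ _] := PQ x y; have [dU _ dV _] := UV x y.
  apply: (is_derive_eq (is_deriveZ 2 (is_deriveD (is_deriveM dP dU) (is_deriveM dQ dV)))).
  by rewrite /GRing.scale /=; ring.
have dmy t : is_derive t (1 : R) (m x) (2 * (Q x t * U x t - P x t * V x t)).
  have [_ dP _ dQ] := PQ x t.
  apply: (is_derive_eq (is_deriveD (is_deriveM dP dP) (is_deriveM dQ dQ))).
  by rewrite /GRing.scale /=; ring.
have ddmy : is_derive y (1 : R) (fun t => 2 * (Q x t * U x t - P x t * V x t))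
   (2 * (U x y ^+ 2 + V x y ^+ 2 - P x y * S x y - Q x y * T x y)).
  have [_ dP _ dQ] := PQ x y; have [_ dU _ dV] := UV x y.
  apply: (is_derive_eq (is_deriveZ 2 (is_deriveB (is_deriveM dQ dU) (is_deriveM dP dV)))).
  by rewrite /GRing.scale /=; ring.
have [ex lx] := @weighted_max R lam (y ^+ 2) x _ rho (s0 + 1) _ _ rho0 dmx ddmx
  (introT andP (conj lo hi)) (fun t tA => hmax (t, y) (mem_set tA)).
have hmaxy t : rho <= t ^+ 2 + x ^+ 2 <= s0 + 1 ->
   m x t * expR (lam * (t ^+ 2 + x ^+ 2)^-1) <= m x y * expR (lam * (y ^+ 2 + x ^+ 2)^-1).
  by rewrite ![_ + x ^+ 2]addrC => tA; apply: (hmax (x, t)); apply: mem_set.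
have lohi : rho < y ^+ 2 + x ^+ 2 < s0 + 1 by rewrite addrC lo hi.
have [ey ly] := @weighted_max R lam (x ^+ 2) y _ rho (s0 + 1) _ _ rho0 dmy ddmy
  lohi hmaxy.
rewrite [y ^+ 2 + x ^+ 2]addrC in ey ly.
apply: (weighted_max_absurd mxy _ lam0 _ ex ey lx ly); first by rewrite invr_gt0.
  by rewrite mulVf // gt_eqF.
by rewrite /m; ring.
Qed.

End holo.

(** * Unique continuation in a coordinate plane *)

Section rigidity.
Context {R : realType}.
Local Notation e := (@coord_vec R).
Implicit Types F G H : C2 R -> R.

#[local] Opaque partial.

Lemma cst_along F i (q : C2 R) x : smooth F ->
  (forall t, partial i F (q + t *: e i) = 0) -> F (q + x *: e i) = F q.
Proof.
move=> sF F0.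
have dF t : is_derive t (1 : R) (fun t => F (q + t *: e i)) 0.
  by rewrite -(F0 t); exact: is_derive_partial.
by have := @is_derive_0_is_cst R _ x 0 dF; rewrite /= scale0r addr0.
Qed.

Lemma plane_continuous F (c : C2 R) i j : continuous F ->
  continuous (fun z : R * R => F (c + z.1 *: e i + z.2 *: e j)).
Proof.
move=> cF z.
have cp : {for z, continuous (fun z : R * R => c + z.1 *: e i + z.2 *: e j)}.
  have c1 : z'.1 @[z' --> z] --> z.1 by exact: cvg_fst.
  have c2 : z'.2 @[z' --> z] --> z.2 by exact: cvg_snd.
  exact: (cvgD (cvgD (cvg_cst c) (cvgZ c1 (cvg_cst (e i)))) (cvgZ c2 (cvg_cst (e j)))).
exact: (cvg_comp _ _ cp (cF _)).
Qed.

Lemma near_plane (A : set (C2 R)) (c : C2 R) i j : (\forall q \near c, A q) ->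
  exists2 rho, 0 < rho &
    forall x y, x ^+ 2 + y ^+ 2 <= rho -> A (c + x *: e i + y *: e j).
Proof.
move=> /nbhs_ballP[/= r r0 rA].
have K0 : 0 < `|e i| + `|e j| + 1 by rewrite ltr_wpDl // addr_ge0.
have [d d0 dr] : exists2 d, 0 < d & d * (`|e i| + `|e j| + 1) = r.
  by exists (r / (`|e i| + `|e j| + 1)); rewrite ?divr_gt0 // divfK // gt_eqF.
exists (d ^+ 2); first by rewrite exprn_gt0.
move=> x y xyd; apply: rA; rewrite -ball_normE /= -addrA opprD addrA subrr.
rewrite add0r normrN (le_lt_trans (ler_normD _ _)) // !normrZ.
have small (z w : R) : z ^+ 2 + w ^+ 2 <= d ^+ 2 -> `|z| <= d.
  move=> h; rewrite -(ler_pXn2r (n := 2)) ?nnegrE ?normr_ge0 ?(ltW d0) //.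
  by rewrite real_normK ?num_real // (le_trans _ h) // lerDl sqr_ge0.
have xd := small _ _ xyd.
have yd : `|y| <= d by apply: (small y x); rewrite addrC.
rewrite -dr !mulrDr mulr1 -addrA ler_ltD ?ler_wpM2r //.
by rewrite (@le_lt_trans _ _ (d * `|e j|)) ?ler_wpM2r // ltrDl.
Qed.

(** The gradient of H in the plane, read as dH/dx_j + i dH/dx_i, is holomorphic
    there by harmonicity and symmetry of second derivatives, and so is its complex
    derivative. *)
Lemma harmonic_plane_eq0 H i j (c : C2 R) : smooth H ->
  (forall q, partial i (partial i H) q + partial j (partial j H) q = 0) ->
  (\forall q \near c, H q = 0) -> forall x y, H (c + x *: e i + y *: e j) = 0.
Proof.
move=> sH harm H0.
have sP k : smooth (partial k H) by exact: smooth_partial.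
have sP2 k l : smooth (partial k (partial l H)) by exact: smooth_partial.
have jj : partial j (partial j H) = fun q => - partial i (partial i H) q.
  by apply/funext => q; apply/eqP; rewrite -addr_eq0 addrC harm.
have ji : partial j (partial i H) = partial i (partial j H) by exact: partial_sym.
pose pl F x y := F (c + x *: e i + y *: e j).
have dx F x y : smooth F -> is_derive x (1 : R) ((pl F)^~ y) (pl (partial i F) x y).
  move=> sF; rewrite /pl (_ : (fun t => _) = fun t => F (c + y *: e j + t *: e i)).
    by rewrite addrAC; exact: is_derive_partial.
  by apply/funext => t; rewrite addrAC.
have dy F x y : smooth F -> is_derive y (1 : R) (pl F x) (pl (partial j F) x y).
  by move=> sF; exact: is_derive_partial.
have [rho rho0 rhoP] := near_plane i j
  (filterI (near_partial0 j H0) (near_partial0 i H0)).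
have D : holo_deriv (pl (partial j H)) (pl (partial i H))
   (pl (partial i (partial j H))) (pl (partial i (partial i H))).
  move=> x y; split.
  - exact: dx (sP j).
  - by apply: (is_derive_eq (dy _ _ _ (sP j))); rewrite jj.
  - exact: dx (sP i).
  - by apply: (is_derive_eq (dy _ _ _ (sP i))); rewrite ji.
have DD : holo_deriv (pl (partial i (partial j H))) (pl (partial i (partial i H)))
   (pl (partial i (partial i (partial j H)))) (pl (partial i (partial i (partial i H)))).
  move=> x y; split.
  - exact: dx (sP2 i j).
  - apply: (is_derive_eq (dy _ _ _ (sP2 i j))).
    by rewrite (partial_sym j i (sP j)) jj /pl partialN.
  - exact: dx (sP2 i i).
  - apply: (is_derive_eq (dy _ _ _ (sP2 i i))).
    by rewrite (partial_sym j i (sP i)) ji.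
have Z := holo_eq0 D DD (plane_continuous (smooth_continuous (sP j)))
  (plane_continuous (smooth_continuous (sP i))) rho0 rhoP.
move=> x y; rewrite (@cst_along H j (c + x *: e i) y sH (fun t => (Z x t).1)).
have Z2 t : partial i H (c + t *: e i) = 0.
  by have := (Z t 0).2; rewrite /pl scale0r addr0.
by rewrite (@cst_along H i c x sH Z2); exact: nbhs_singleton H0.
Qed.

(** * The closedness equations with compactly supported f *)

Lemma sum4 (V : nmodType) (F : 'I_4 -> V) :
  \sum_i F i = F ix1 + F iy1 + F ix2 + F iy2.
Proof.
rewrite !big_ord_recr big_ord0 /= add0r.
by congr (F _ + F _ + F _ + F _); exact: val_inj.
Qed.

Lemma coord_decomp (v : C2 R) :
  v = v ix1 0 *: e ix1 + v iy1 0 *: e iy1 + v ix2 0 *: e ix2 + v iy2 0 *: e iy2.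
Proof. by rewrite -[LHS]coord_sum sum4. Qed.

Lemma bounded_support (f : C2 R -> R) : compact_support f ->
  exists M, forall p, f p != 0 -> p ix2 0 <= M.
Proof.
move=> /compact_bounded[M [_ MP]]; exists (M + 1) => p fp.
have pn : `|p| <= M + 1 by apply: MP; [rewrite ltrDl|exact: subset_closure].
apply: le_trans (ler_norm _) (le_trans _ pn).
by rewrite [leRHS]/Num.Def.normr /= mx_normrE; apply: (le_bigmax _ _ (ix2, ord0)).
Qed.

(** The first two equations are d-bar of b + i a in z1, the last two its
    holomorphy in z2.  Harmonicity of w in z2 follows by differentiating the first
    two and exchanging derivatives; as w vanishes where x2 is large, unique
    continuation gives w = 0.  Now a is harmonic in each of the two complex
    coordinate planes and zero near p0: continuing in z2 makes it zero near every
    point with the same z1 as p0, and continuing from there in z1 reaches all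
    points. *)
Lemma rigidity (f a b w : C2 R -> R) :
  smooth f -> smooth a -> smooth b -> smooth w ->
  (forall p, w p = f p * a p) ->
  (forall p, partial ix1 b p - partial iy1 a p = partial ix2 w p) ->
  (forall p, partial ix1 a p + partial iy1 b p = - partial iy2 w p) ->
  (forall p, partial iy2 a p = partial ix2 b p) ->
  (forall p, partial ix2 a p = - partial iy2 b p) ->
  compact_support f -> (exists p, f p != 0) ->
  forall p, a p = 0 /\ b p = b 0.
Proof.
move=> sf sa sb sw wE e123 e124 e134 e234 cf [p0 fp0].
have spa k : smooth (partial k a) by exact: smooth_partial.
have spb k : smooth (partial k b) by exact: smooth_partial.
have a4 : partial iy2 a = partial ix2 b by apply/funext.
have a3 : partial ix2 a = fun p => - partial iy2 b p by apply/funext.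
have w0 p : w p = 0.
  have w3 : partial ix2 w = fun p => partial ix1 b p + - partial iy1 a p.
    by apply/funext => q; rewrite -e123.
  have w4 : partial iy2 w = fun p => - (partial ix1 a p + partial iy1 b p).
    by apply/funext => q; rewrite e124 opprK.
  have harm q : partial ix2 (partial ix2 w) q + partial iy2 (partial iy2 w) q = 0.
    rewrite w3 w4 partialN; last exact: smoothD.
    rewrite !partialD //; last exact: smoothN.
    rewrite partialN // (partial_sym ix2 ix1 sb) (partial_sym ix2 iy1 sa).
    rewrite (partial_sym iy2 ix1 sa) (partial_sym iy2 iy1 sb) a3 a4.
    by rewrite partialN // opprK subrr.
  have [M MP] := bounded_support cf.
  (* a point of the z2-plane through p, beyond the support of f *)
  pose c := p + (M + 1 - p ix2 0) *: e ix2.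
  have far : \forall q \near c, w q = 0.
    have : \forall q \near c, M < (q : C2 R) ix2 0.
      have cc : (q : C2 R) ix2 0 @[q --> c] --> c ix2 0 by exact: coord_continuous.
      have cM : M < c ix2 0 by rewrite !mxE /= mulr1 addrC subrK ltrDl.
      exact: (cvgr_gt _ cc _ cM).
    apply: filterS => q qM; rewrite wE (_ : f q = 0) ?mul0r //.
    by apply/eqP; apply: contraTT qM => /MP; rewrite -leNgt.
  have := harmonic_plane_eq0 sw harm far (- (M + 1 - p ix2 0)) 0.
  by rewrite scale0r addr0 /c -addrA -scalerDl subrr scale0r addr0.
have w' k p : partial k w p = 0.
  by rewrite (_ : w = fun=> 0) ?partial_cst //; apply/funext.
have a1 : partial ix1 a = fun p => - partial iy1 b p.
  apply/funext => p; apply/eqP; rewrite -addr_eq0 e124 w' oppr0 //.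
have a2 : partial iy1 a = partial ix1 b.
  by apply/funext => p; apply/esym/eqP; rewrite -subr_eq0 e123 w'.
have harm1 q : partial ix1 (partial ix1 a) q + partial iy1 (partial iy1 a) q = 0.
  by rewrite a1 a2 partialN // (partial_sym iy1 ix1 sb) addNr.
have harm2 q : partial ix2 (partial ix2 a) q + partial iy2 (partial iy2 a) q = 0.
  by rewrite a3 a4 partialN // (partial_sym iy2 ix2 sb) addNr.
have a0 : \forall q \near p0, a q = 0.
  have : \forall q \near p0, f q != 0 by exact: (cvgr_neq0 _ (smooth_continuous sf p0) fp0).
  apply: filterS => q fq; move/eqP: (w0 q).
  by rewrite wE mulf_eq0 (negbTE fq) => /eqP.
have {}a0 p : a p = 0.
  have [v ->] : exists v, p = p0 + v by exists (p - p0); rewrite addrC subrK.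
  rewrite [v in p0 + v]coord_decomp.
  move: (v ix1 0) (v iy1 0) (v ix2 0) (v iy2 0) => x1 y1 x2 y2.
  have -> : p0 + (x1 *: e ix1 + y1 *: e iy1 + x2 *: e ix2 + y2 *: e iy2) =
      p0 + (x2 *: e ix2 + y2 *: e iy2) + x1 *: e ix1 + y1 *: e iy1.
    by rewrite -[x1 *: _ + _ + _ + _]addrA [x1 *: _ + _ + _]addrC !addrA.
  move uE : (x2 *: e ix2 + y2 *: e iy2) => u.
  apply: (harmonic_plane_eq0 sa harm1).
  have sh : q - u @[q --> p0 + u] --> p0.
    by rewrite -[X in _ --> X](addrK u p0); exact: (cvgB cvg_id (cvg_cst u)).
  have : \forall q \near p0 + u, \forall q' \near q - u, a q' = 0.
    exact: (sh _ (nbhs_interior a0)).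
  apply: filterS => q aq.
  have -> : q = q - u + x2 *: e ix2 + y2 *: e iy2.
    by rewrite -[_ + y2 *: _]addrA uE subrK.
  exact: (harmonic_plane_eq0 sa harm2 aq).
move=> p; split=> //.
have a' k q : partial k a q = 0.
  by rewrite (_ : a = fun=> 0) ?partial_cst //; apply/funext.
have b1 q : partial ix1 b q = 0 by rewrite -a2.
have b2 q : partial iy1 b q = 0.
  by apply/eqP; rewrite -oppr_eq0; apply/eqP; move: (a' ix1 q); rewrite a1.
have b3 q : partial ix2 b q = 0 by rewrite -a4.
have b4 q : partial iy2 b q = 0.
  by apply/eqP; rewrite -oppr_eq0; apply/eqP; move: (a' ix2 q); rewrite a3.
by rewrite (coord_decomp p) -[X in b (X + _ + _ + _)]add0r !(@cst_along b).
Qed.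

End rigidity.

(** * The structures i + f A and their Nijenhuis tensor *)

Section geometry.
Context {R : realType}.
Local Notation e := (@coord_vec R).

Lemma ord4P (k : 'I_4) : [\/ k = ix1, k = iy1, k = ix2 | k = iy2].
Proof.
by case: k => -[|[|[|[|]]]] // lt4; [apply: Or41|apply: Or42|apply: Or43|apply: Or44];
  apply/val_inj.
Qed.

(** The antilinear map A, from the z1-plane to the z2-plane. *)
Definition twist : 'M[R]_4 := delta_mx ix2 ix1 - delta_mx iy2 iy1.

Definition twisted_mx (t : R) : 'M[R]_4 := std_complex R + t *: twist.

Lemma twisted_mx_sqr t : twisted_mx t *m twisted_mx t = - 1%:M.
Proof.
apply/matrixP => i j; rewrite /twisted_mx /std_complex /twist !mxE sum4 !mxE.
by case: (ord4P i) => ->; case: (ord4P j) => -> /=; ring.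
Qed.

Lemma twisted_mx_std t : twisted_mx t = std_complex R <-> t = 0.
Proof.
rewrite /twisted_mx; split=> [|->]; last by rewrite scale0r addr0.
move=> /matrixP /(_ ix2 ix1); rewrite /twist !mxE /=.
by rewrite !subr0 !addr0 add0r mulr1.
Qed.

Lemma twisted_mxE t (v : C2 R) :
  [/\ (twisted_mx t *m v) ix1 0 = - v iy1 0, (twisted_mx t *m v) iy1 0 = v ix1 0,
      (twisted_mx t *m v) ix2 0 = t * v ix1 0 - v iy2 0 &
      (twisted_mx t *m v) iy2 0 = - t * v iy1 0 + v ix2 0].
Proof.
by split; rewrite /twisted_mx /std_complex /twist !mxE sum4 !mxE /=; ring.
Qed.

Lemma twistE (v : C2 R) :
  [/\ (twist *m v) ix1 0 = 0, (twist *m v) iy1 0 = 0,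
      (twist *m v) ix2 0 = v ix1 0 & (twist *m v) iy2 0 = - v iy1 0].
Proof.
by split; rewrite /twist !mxE sum4 !mxE /=; ring.
Qed.

Definition Jtwist (f : C2 R -> R) : tensor11 R := fun p => twisted_mx (f p).

Lemma almost_complex_Jtwist f : smooth f -> almost_complex (Jtwist f).
Proof.
move=> sf; split; last by move=> p; exact: twisted_mx_sqr.
by move=> k; exact: Ck_affine (sf k).
Qed.

Definition dir (f : C2 R -> R) (p v : C2 R) := \sum_i v i 0 * partial i f p.

Lemma is_derive_Jtwist f p v : smooth f ->
  is_derive p v (Jtwist f) (dir f p v *: twist).
Proof.
move=> sf; apply/is_derive_mxP => i j; rewrite mxE.
have -> : (fun q => Jtwist f q i j) = cst (std_complex R i j) + twist i j *: f.
  by apply/funext => q; rewrite /Jtwist /twisted_mx !mxE mulrC.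
apply: (is_derive_eq (is_deriveD (is_derive_cst _ _ _)
  (is_deriveZ _ (is_derive_smooth p v sf)))).
by rewrite add0r mulrC.
Qed.

(** The cancellation making the Nijenhuis tensor tensorial: D1 to D4 stand for the
    derivatives of the two vector fields and A1 to A4 for the terms in which J is
    differentiated; J^2 = - id removes all the former. *)
Lemma nijenhuis_cancel (J : 'M[R]_4) (A1 A2 A3 A4 D1 D2 D3 D4 : C2 R) :
  J *m J = - 1%:M ->
  A1 + J *m D3 - (A2 + J *m D4) - (D2 - D1) - J *m (D3 - (A3 + J *m D1))
    - J *m (A4 + J *m D2 - D4) = A1 - A2 + J *m A3 - J *m A4.
Proof.
move=> JJ; rewrite !mulmxBr !mulmxDr !mulmxA JJ !mulNmx !mul1mx.
move: (J *m D3) (J *m D4) (J *m A3) (J *m A4) => E3 E4 E5 E6.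
by apply/colP => i; rewrite !mxE; ring.
Qed.

Lemma nijenhuis_Jtwist f (X Y : vector_field R) p :
  smooth f -> smooth X -> smooth Y ->
  nijenhuis (Jtwist f) X Y p =
    dir f p (twisted_mx (f p) *m X p) *: (twist *m Y p)
    - dir f p (twisted_mx (f p) *m Y p) *: (twist *m X p)
    + dir f p (Y p) *: (twisted_mx (f p) *m (twist *m X p))
    - dir f p (X p) *: (twisted_mx (f p) *m (twist *m Y p)).
Proof.
move=> sf sX sY.
have dtapp (Z : vector_field R) v : smooth Z ->
    'D_v (tapp (Jtwist f) Z) p =
      dir f p v *: (twist *m Z p) + Jtwist f p *m 'D_v Z p.
  move=> sZ; have dZ := derivableP (@smooth_derivable_dir R _ _ Z p v sZ).
  have [_ ->] := is_derive_mulmx (is_derive_Jtwist p v sf) dZ.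
  by rewrite scalemxAl.
pose JX := tapp (Jtwist f) X; pose JY := tapp (Jtwist f) Y.
transitivity ('D_(JX p) JY p - 'D_(JY p) JX p - ('D_(X p) Y p - 'D_(Y p) X p)
  - Jtwist f p *m ('D_(JX p) Y p - 'D_(Y p) JX p)
  - Jtwist f p *m ('D_(X p) JY p - 'D_(JY p) X p)) => //.
rewrite (dtapp X _ sX) (dtapp X _ sX) (dtapp Y _ sY) (dtapp Y _ sY) !scalemxAr.
exact: nijenhuis_cancel (twisted_mx_sqr _).
Qed.

Lemma smooth_coord_field i : smooth (fun=> e i : C2 R).
Proof. exact: smooth_cst. Qed.

Lemma nijenhuis_entries f p (x y : C2 R) :
  let t := f p in let f3 := partial ix2 f p in let f4 := partial iy2 f p in
  let N := dir f p (twisted_mx t *m x) *: (twist *m y)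
    - dir f p (twisted_mx t *m y) *: (twist *m x)
    + dir f p y *: (twisted_mx t *m (twist *m x))
    - dir f p x *: (twisted_mx t *m (twist *m y)) in
  [/\ N ix1 0 = 0, N iy1 0 = 0,
    N ix2 0 =
      f3 * (x iy2 0 * - y ix1 0 + y iy2 0 * x ix1 0 + y ix2 0 * x iy1 0 - x ix2 0 * y iy1 0)
      + f4 * (t * (y iy1 0 * x ix1 0 - x iy1 0 * y ix1 0) + x ix2 0 * y ix1 0
        - y ix2 0 * x ix1 0 + y iy2 0 * x iy1 0 - x iy2 0 * y iy1 0) &
    N iy2 0 =
      f3 * (t * (y ix1 0 * x iy1 0 - x ix1 0 * y iy1 0) + x iy2 0 * y iy1 0
        - y iy2 0 * x iy1 0 + y ix2 0 * x ix1 0 - x ix2 0 * y ix1 0)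
      + f4 * (y ix2 0 * x iy1 0 - x ix2 0 * y iy1 0 + y iy2 0 * x ix1 0
        - x iy2 0 * y ix1 0)].
Proof.
have lin (a b c d : R) (U V W Z : C2 R) k :
    (a *: U - b *: V + c *: W - d *: Z) k 0 =
    a * U k 0 - b * V k 0 + c * W k 0 - d * Z k 0 by rewrite !mxE.
move=> t f3 f4 N; rewrite /N {N} !lin /dir !sum4 -/f3 -/f4.
move: (partial ix1 f p) (partial iy1 f p) f3 f4 => f1 f2 f3 f4.
have [-> -> -> ->] := twisted_mxE t (twist *m x).
have [-> -> -> ->] := twisted_mxE t (twist *m y).
have [-> -> -> ->] := twisted_mxE t x.
have [-> -> -> ->] := twisted_mxE t y.
have [-> -> -> ->] := twistE x.
have [-> -> -> ->] := twistE y.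
move: (x ix1 0) (x iy1 0) (x ix2 0) (x iy2 0) => x1 x2 x3 x4.
move: (y ix1 0) (y iy1 0) (y ix2 0) (y iy2 0) => y1 y2 y3 y4.
by split; ring.
Qed.

Lemma integrable_Jtwist f : smooth f -> integrable_acs (Jtwist f) <->
  forall p, partial ix2 f p = 0 /\ partial iy2 f p = 0.
Proof.
move=> sf; split=> [N0 p|f0 X Y sX sY p].
  have := N0 _ _ (smooth_coord_field ix2) (smooth_coord_field ix1) p.
  rewrite (nijenhuis_Jtwist p sf (smooth_coord_field _) (smooth_coord_field _)).
  have [_ _ +  +] := nijenhuis_entries f p (e ix2) (e ix1).
  move=> + + N; rewrite N !mxE /=.
  rewrite !(mulr0, mul0r, oppr0, addr0, add0r, mulr1, mul1r, subr0).
  move=> E3 E4; split=> //; apply/eqP; rewrite -oppr_eq0; apply/eqP.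
  by rewrite E4; ring.
rewrite (nijenhuis_Jtwist p sf sX sY).
have [E1 E2 E3 E4] := nijenhuis_entries f p (X p) (Y p).
have [f3 f4] := f0 p.
apply/colP => k; rewrite [RHS]mxE; case: (ord4P k) => ->.
- by rewrite E1.
- by rewrite E2.
- by rewrite E3 f3 f4 !mul0r addr0.
- by rewrite E4 f3 f4 !mul0r addr0.
Qed.

(** * Anti-invariant forms *)

Lemma anti_invariant_mxP (J : tensor11 R) (alpha : C2 R -> 'M[R]_4) :
  anti_invariant J alpha <-> forall p, (J p)^T *m alpha p *m J p = - alpha p.
Proof.
have formE (X Y : vector_field R) p :
    form_app alpha (tapp J X) (tapp J Y) p =
    ((X p)^T *m ((J p)^T *m alpha p *m J p) *m Y p) 0 0.
  by rewrite /form_app /tapp trmx_mul !mulmxA.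
split=> [inv p|H X Y _ _ p]; last by rewrite formE H mulmxN mulNmx mxE.
apply/matrixP => i j.
have := inv _ _ (smooth_coord_field i) (smooth_coord_field j) p.
rewrite formE /form_app /coord_vec trmx_delta -!rowE -!colE !mxE.
by [].
Qed.

Lemma mulmx_twisted m t (M : 'M[R]_(m, 4)) i :
  [/\ (M *m twisted_mx t) i ix1 = M i iy1 + t * M i ix2,
      (M *m twisted_mx t) i iy1 = - M i ix1 - t * M i iy2,
      (M *m twisted_mx t) i ix2 = M i iy2 &
      (M *m twisted_mx t) i iy2 = - M i ix2].
Proof.
by split; rewrite !mxE sum4 /twisted_mx /std_complex /twist !mxE /=; ring.
Qed.

Lemma anti_invariant_entries (M : 'M[R]_4) (t : R) : M^T = - M ->
  (twisted_mx t)^T *m M *m twisted_mx t = - M ->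
  [/\ M ix1 iy1 = - (t * M ix1 ix2), M iy1 iy2 = - M ix1 ix2,
      M iy1 ix2 = M ix1 iy2 & M ix2 iy2 = 0].
Proof.
move=> anti inv.
have E i j : M j i = - M i j by move/matrixP/(_ i j): anti; rewrite !mxE.
have ent i j : ((M *m twisted_mx t)^T *m twisted_mx t) i j = M i j.
  have -> : (M *m twisted_mx t)^T *m twisted_mx t = M; last by [].
  by rewrite trmx_mul anti mulmxN mulNmx inv opprK.
have col k : (M *m twisted_mx t)^T ix1 k = M k iy1 + t * M k ix2.
  by rewrite mxE; have [] := mulmx_twisted t M k.
have [_ R2 R3 R4] := mulmx_twisted t (M *m twisted_mx t)^T ix1.
have [_ _ _ R4'] := mulmx_twisted t (M *m twisted_mx t)^T ix2.
have col' : (M *m twisted_mx t)^T ix2 ix2 = M ix2 iy2.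
  by rewrite mxE; have [] := mulmx_twisted t M ix2.
have := ent ix1 iy1; have := ent ix1 ix2; have := ent ix1 iy2; have := ent ix2 iy2.
rewrite R2 R3 R4 R4' !col col'.
rewrite (E iy1 ix2) (E iy1 iy2) (E ix2 iy2).
have Z k : M k k = 0 by have := E k k; move: (M k k) => u; lra.
rewrite !Z.
move: (M ix1 iy1) (M ix1 ix2) (M ix1 iy2) (M iy1 ix2) (M iy1 iy2) (M ix2 iy2).
move=> m12 m13 m14 m23 m24 m34; clear.
move=> h34 h14 h13 h12.
have m0 : m34 = 0 by lra.
have m24E : m24 = - m13 by move: h13; rewrite m0; lra.
by move: h14 h12; rewrite m0 m24E => h14 h12; split; lra.
Qed.

(** The Gram matrix of Im (dz1 /\ dz2) = dx1 /\ dy2 + dy1 /\ dx2. *)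
Definition im_dz1dz2 : 'M[R]_4 :=
  delta_mx ix1 iy2 - delta_mx iy2 ix1 + delta_mx iy1 ix2 - delta_mx ix2 iy1.

Lemma im_dz1dz2_anti_invariant t :
  (twisted_mx t)^T *m im_dz1dz2 *m twisted_mx t = - im_dz1dz2.
Proof.
suff -> : (twisted_mx t)^T *m im_dz1dz2 = im_dz1dz2 *m twisted_mx t.
  by rewrite -mulmxA twisted_mx_sqr mulmxN mulmx1.
apply/matrixP => i j; rewrite !mxE !sum4 /im_dz1dz2 /twisted_mx /std_complex /twist !mxE.
by case: (ord4P i) => ->; case: (ord4P j) => -> /=; ring.
Qed.

Lemma entries4 (A B : 'M[R]_4) : A^T = - A -> B^T = - B ->
  A ix1 iy1 = B ix1 iy1 -> A ix1 ix2 = B ix1 ix2 -> A ix1 iy2 = B ix1 iy2 ->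
  A iy1 ix2 = B iy1 ix2 -> A iy1 iy2 = B iy1 iy2 -> A ix2 iy2 = B ix2 iy2 -> A = B.
Proof.
move=> aA aB h12 h13 h14 h23 h24 h34.
have EA i j : A j i = - A i j by move/matrixP/(_ i j): aA; rewrite !mxE.
have EB i j : B j i = - B i j by move/matrixP/(_ i j): aB; rewrite !mxE.
have dA i : A i i = 0 by have := EA i i; move: (A i i) => u; lra.
have dB i : B i i = 0 by have := EB i i; move: (B i i) => u; lra.
apply/matrixP => i j.
case: (ord4P i) => ->; case: (ord4P j) => ->; rewrite ?dA ?dB //.
all: by rewrite EA EB ?h12 ?h13 ?h14 ?h23 ?h24 ?h34.
Qed.

End geometry.

Section h_minus.
Context {R : realType}.

Lemma im_dz1dz2_closed_anti_invariant (f : C2 R -> R) (c : R) :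
  closed_anti_invariant_forms (Jtwist f) (fun=> c *: im_dz1dz2).
Proof.
split.
- split; first exact: smooth_cst.
  by move=> _; apply/matrixP => i j; rewrite /im_dz1dz2 !mxE
    [(j == ix1) && _]andbC [(j == iy1) && _]andbC [(j == ix2) && _]andbC
    [(j == iy2) && _]andbC; ring.
- by move=> i j k p; rewrite /ext_deriv !partial_cst !addr0.
- apply/anti_invariant_mxP => p.
  by rewrite -scalemxAr -scalemxAl im_dz1dz2_anti_invariant scalerN.
Qed.

(** The parameters are a = alpha(d/dx1, d/dx2) and b = alpha(d/dx1, d/dy2); the four
    components of d alpha are the four equations of [rigidity]. *)
Lemma closed_anti_invariant_cst (f : C2 R -> R) (alpha : C2 R -> 'M[R]_4) :
  smooth f -> compact_support f -> (exists p, f p != 0) ->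
  closed_anti_invariant_forms (Jtwist f) alpha ->
  exists c : R, alpha = fun=> c *: im_dz1dz2.
Proof.
move=> sf cf fN0 [[salpha anti] cl /anti_invariant_mxP inv].
have sij i j : smooth (fun p => alpha p i j) by exact: smooth_coord.
have E i j p : alpha p j i = - alpha p i j.
  by move/matrixP/(_ i j): (anti p); rewrite !mxE.
have rel p := anti_invariant_entries (anti p) (inv p).
pose a p := alpha p ix1 ix2; pose b p := alpha p ix1 iy2.
pose w p := - alpha p ix1 iy1.
have sa : smooth a by exact: sij.
have sb : smooth b by exact: sij.
have sw : smooth w by apply: smoothN; exact: sij.
have a12 : (fun p => alpha p ix1 iy1) = fun p => - w p.
  by apply/funext => p; rewrite /w opprK.
have a24 : (fun p => alpha p iy1 iy2) = fun p => - a p.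
  by apply/funext => p; have [] := rel p.
have a42 : (fun p => alpha p iy2 iy1) = a.
  by apply/funext => p; rewrite E; have [_ -> _ _] := rel p; rewrite opprK.
have a23 : (fun p => alpha p iy1 ix2) = b.
  by apply/funext => p; have [] := rel p.
have a31 : (fun p => alpha p ix2 ix1) = fun p => - a p.
  by apply/funext => p; rewrite E.
have a41 : (fun p => alpha p iy2 ix1) = fun p => - b p.
  by apply/funext => p; rewrite E.
have a34 : (fun p => alpha p ix2 iy2) = fun=> 0.
  by apply/funext => p; have [] := rel p.
have wE p : w p = f p * a p.
  by rewrite /w; have [-> _ _ _] := rel p; rewrite opprK.
have e123 p : partial ix1 b p - partial iy1 a p = partial ix2 w p.
  have := cl ix1 iy1 ix2 p; rewrite /ext_deriv a23 a31 a12 !partialN //.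
  by move=> /eqP; rewrite subr_eq0 => /eqP.
have e124 p : partial ix1 a p + partial iy1 b p = - partial iy2 w p.
  have := cl ix1 iy1 iy2 p; rewrite /ext_deriv a24 a41 a12 !partialN //.
  by rewrite -!opprD => /eqP; rewrite oppr_eq0 addr_eq0 => /eqP.
have e134 p : partial iy2 a p = partial ix2 b p.
  have := cl ix1 ix2 iy2 p; rewrite /ext_deriv a34 a41 partial_cst !partialN //.
  by rewrite add0r addrC => /eqP; rewrite subr_eq0 => /eqP.
have e234 p : partial ix2 a p = - partial iy2 b p.
  have := cl iy1 ix2 iy2 p; rewrite /ext_deriv a34 a42 a23 partial_cst.
  by rewrite add0r => /eqP; rewrite addr_eq0 => /eqP.
have ab := rigidity sf sa sb sw wE e123 e124 e134 e234 cf fN0.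
exists (b 0); apply/funext => p; have [ap0 bp] := ab p.
have [r12 r24 r23 r34] := rel p.
apply: (entries4 (anti p)).
- have [[_ +] _ _] := im_dz1dz2_closed_anti_invariant f (b 0).
  by move=> /(_ p).
- by rewrite r12 -/(a p) ap0 mulr0 oppr0 !mxE /=; ring.
- by rewrite -/(a p) ap0 !mxE /=; ring.
- by rewrite -/(b p) bp !mxE /=; ring.
- by rewrite r23 -/(b p) bp !mxE /=; ring.
- by rewrite r24 -/(a p) ap0 !mxE /=; ring.
- by rewrite r34 !mxE /=; ring.
Qed.

Lemma h_minus_Jtwist (f : C2 R -> R) : smooth f -> compact_support f ->
  (exists p, f p != 0) -> h_minus_is (Jtwist f) 1.
Proof.
move=> sf cf fN0; exists (fun _ => fun=> im_dz1dz2); split=> [c|].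
  rewrite big_ord1 => /(congr1 (fun F : C2 R -> 'M[R]_4 => F 0 ix1 iy2)) c0 i.
  move: c0; rewrite [i]ord1 /GRing.scale /= !mxE /=.
  by rewrite !(subr0, addr0, mulr1).
apply: funext => alpha; apply: propext.
split=> [/(closed_anti_invariant_cst sf cf fN0)[c ->]|[c ->]].
  by exists (fun=> c); rewrite big_ord1.
by rewrite big_ord1; exact: im_dz1dz2_closed_anti_invariant.
Qed.

End h_minus.

Theorem mainTheorem2 (R : realType) :
  exists J : (C2 R -> R) -> tensor11 R,
    forall f : C2 R -> R, smooth f ->
      [/\ almost_complex (J f),
          (forall p, J f p = std_complex R <-> f p = 0),
          (integrable_acs (J f) <->
             forall p, partial ix2 f p = 0 /\ partial iy2 f p = 0)
        & (compact_support f -> (exists p, f p != 0) -> h_minus_is (J f) 1)].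
Proof.
exists Jtwist => f sf; split.
- exact: almost_complex_Jtwist.
- by move=> p; exact: twisted_mx_std.
- exact: integrable_Jtwist.
- exact: h_minus_Jtwist.
Qed.
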